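(* Let $J\in\mathbb{R}^{2N\times 2N}$ be skew-symmetric and invertible, let $H(t)\in\mathbb{R}^{2N\times 2N}$ be symmetric and $P$-periodic, and let $(X(t))_{t\ge 0}$ be the fundamental solution of $$J\frac{dX(t)}{dt}=H(t)X(t),\quad t\ge 0,\qquad X(0)=I_{2N}.$$ Let $U$ be a constant $2N\times k$ matrix of rank $k$ whose columns belong to a $J$-Lagrangian subspace. Consider the perturbed Hamiltonian system $$J\frac{d\widetilde{X}(t)}{dt}=\left[H(t)+E(t)\right]\widetilde{X}(t),$$ where $$E(t)=(JUU^{T}H(t))^{T}+JUU^{T}H(t)+(UU^{T}J)^{T}H(t)(UU^{T}J).$$ Then $\widetilde{X}(t)=(I+UU^{T}J)X(t)$ is a solution of this perturbed system.
   Context: $P>0$ and $H(t+P)=H(t)=H(t)^T$. The fundamental solution $X(t)$ is the solution of the stated initial value problem. $U^T$ denotes the (non-conjugate) transpose. A subspace $\mathcal{L}\subseteq\mathbb{C}^{2N}$ is $J$-Lagrangian if $\dim\mathcal{L}=N$ and $\langle Jx,y\rangle=0$ for all $x,y\in\mathcal{L}$, where $\langle x,y\rangle=\sum_{j=1}^{2N}x_jy_j$ (bilinear). *)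

(* Defs.v *)
From HB Require Import structures.
From mathcomp Require Import all_boot all_order all_algebra.
From mathcomp Require Import complex.
From mathcomp Require Import all_classical all_reals all_analysis.

Set Implicit Arguments.
Unset Strict Implicit.
Unset Printing Implicit Defensive.

Import Order.TTheory GRing.Theory Num.Theory.
Import numFieldNormedType.Exports.

Local Open Scope classical_set_scope.
Local Open Scope ring_scope.
Local Open Scope complex_scope.

Definition cmx (R : realType) (m n : nat) (A : 'M[R]_(m, n)) : 'M[R[i]]_(m, n) :=
  map_mx (real_complex R) A.

(* No conjugation: a bilinear form, not the Hermitian product. *)
Definition bilin (R : realType) (n : nat) (x y : 'cV[R[i]]_n) : R[i] :=
  \sum_(j < n) x j 0 * y j 0.

Definition J_Lagrangian (R : realType) (N : nat) (J : 'M[R]_(2 * N))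
    (L : {vspace 'cV[R[i]]_(2 * N)}) : Prop :=
  \dim L = N /\ forall x y, x \in L -> y \in L -> bilin (cmx J *m x) y = 0.

(* One-sided at t = 0: only increments h with 0 <= t + h are considered, so
   nothing is required of X on negative times. The library equips R[i]^o, not
   R[i], with the norm topology; on matrices it is the product topology. *)
Definition derivative_at (R : realType) (m n : nat) (X : R -> 'M[R[i]]_(m, n))
    (t : R) (D : 'M[R[i]]_(m, n)) : Prop :=
  (h%:C)^-1 *: (X (t + h) - X t) @[h --> within [set h | 0 <= t + h] 0^'] -->
    (D : 'M[R[i]^o]_(m, n)).

(* J X' = K X at every t >= 0, in the classical (pointwise) sense. *)
Definition solves (R : realType) (n m : nat) (J : 'M[R]_n)
    (K : R -> 'M[R[i]]_n) (X : R -> 'M[R[i]]_(n, m)) : Prop :=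
  forall t : R, 0 <= t ->
    exists2 D, derivative_at X t D & cmx J *m D = K t *m X t.

Definition fundamental_solution (R : realType) (n : nat) (J : 'M[R]_n)
    (K : R -> 'M[R[i]]_n) (X : R -> 'M[R[i]]_n) : Prop :=
  solves J K X /\ X 0 = 1%:M.

Definition perturbation (R : realType) (n k : nat) (J : 'M[R]_n)
    (U : 'M[R[i]]_(n, k)) (H : R -> 'M[R]_n) (t : R) : 'M[R[i]]_n :=
  (cmx J *m U *m U^T *m cmx (H t))^T + cmx J *m U *m U^T *m cmx (H t)
  + (U *m U^T *m cmx J)^T *m cmx (H t) *m (U *m U^T *m cmx J).

(* Main.v *)
(* Write M = U U^T. Since the columns of U lie in a Lagrangian subspace,
   U^T J U = 0, so M J squares to zero and I + M J has inverse I - M J.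
   Expanding E gives H + E = (I + J M) H (I - M J), hence
   (H + E)(I + M J) X = (I + J M) H X = (I + J M) J X' = J (I + M J) X'. *)
Require Import Defs.
From HB Require Import structures.
From mathcomp Require Import all_boot all_order all_algebra.
From mathcomp Require Import complex.
From mathcomp Require Import all_classical all_reals all_analysis.
Import Order.TTheory GRing.Theory Num.Theory.
Import numFieldNormedType.Exports.
Local Open Scope classical_set_scope.
Local Open Scope ring_scope.
Local Open Scope complex_scope.

(** A neighbourhood of [M] contains a product of neighbourhoods of its entries, and there are
    finitely many entries, so the filter is closed under the intersection of the entrywise
    conditions. *)
Lemma cvg_mx (T : Type) (F : set_system T) (FF : Filter F)
   (V : topologicalType) m n (f : T -> 'M[V]_(m, n)) (M : 'M[V]_(m, n)) :
  (forall i j, f x i j @[x --> F] --> M i j) -> f x @[x --> F] --> M.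
Proof.
move=> fM A [B BM sBA]; rewrite /nbhs/=.
apply: (@filterS _ F _ [set x | forall i j, B i j (f x i j)]).
  by move=> x Bx; exact: sBA.
by apply: filter_forall => i; apply: filter_forall => j; exact: fM (BM i j).
Qed.

Lemma mulmxl_continuous (K : numFieldType) m n p (A : 'M[K]_(m, n)) :
  continuous (mulmx A : 'M[K^o]_(n, p) -> 'M[K^o]_(m, p)).
Proof.
move=> M; apply: (@cvg_mx _ _ (nbhs_filter M) K^o _ _ (mulmx A)) => i j.
rewrite mxE; under eq_fun do rewrite mxE.
apply: cvg_big => [|k _].
  exact: add_continuous.
apply: cvgM; first exact: cvg_cst.
exact: (@coord_continuous K).
Qed.

(** By linearity [A] factors out of the difference quotient on the left; its continuity then carries
    the limit over. *)
Lemma derivative_at_mulmxl (R : realType) m n p (A : 'M[R[i]]_(m, n))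
    (X : R -> 'M[R[i]]_(n, p)) t D :
  derivative_at X t D -> derivative_at (fun s => A *m X s) t (A *m D).
Proof.
move=> XD; rewrite /derivative_at.
under eq_fun do rewrite -mulmxBr scalemxAr.
exact: (cvg_comp _ _ XD (@mulmxl_continuous _ m n p A D)).
Qed.

Lemma bilinE (R : realType) n (x y : 'cV[R[i]]_n) : bilin x y = (x^T *m y) 0 0.
Proof. by rewrite mxE; apply: eq_bigr => j _; rewrite mxE. Qed.

(** For columns u_i, u_j of [U], skew-symmetry gives <J u_i, u_j> = - u_i^T J u_j, which is minus
    the (i, j) entry of U^T J U. *)
Lemma Lagrangian_tr_mul_eq0 (R : realType) N k (J : 'M[R]_(2 * N))
    (U : 'M[R[i]]_(2 * N, k)) (L : {vspace 'cV[R[i]]_(2 * N)}) :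
  J^T = - J -> J_Lagrangian J L -> (forall j, col j U \in L) ->
  U^T *m cmx J *m U = 0.
Proof.
move=> JT [_ LJ] UL; apply/matrixP => i j.
have := LJ _ _ (UL i) (UL j); rewrite bilinE trmx_mul /cmx map_trmx JT.
rewrite map_mxN mulmxN mulNmx tr_col -!row_mul colE mulmxA -colE.
by rewrite !mxE => /eqP; rewrite oppr_eq0 => /eqP.
Qed.

(** Pure algebra: [U] enters only through M = U U^T, by its symmetry and M J M = 0. *)
Lemma symplectic_perturbationE (F : comPzRingType) n (J M H : 'M[F]_n) :
  J^T = - J -> H^T = H -> M^T = M -> M *m J *m M = 0 ->
  (H + ((J *m M *m H)^T + J *m M *m H + (M *m J)^T *m H *m (M *m J)))
    *m (1%:M + M *m J) = (1%:M + J *m M) *m H.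
Proof.
move=> JT HT MT MJM.
have MJ2 : M *m J *m (M *m J) = 0 by rewrite mulmxA MJM mul0mx.
rewrite !trmx_mul MT JT HT !mulmxN !mulNmx.
(* The minus signs come from the transposes: (J M H)^T = - H M J and (M J)^T = - J M. *)
have -> : H + (- (H *m (M *m J)) + J *m M *m H - J *m M *m H *m (M *m J))
  = (1%:M + J *m M) *m H *m (1%:M - M *m J).
  rewrite mulmxBr mulmx1 !mulmxDl mul1mx opprD !addrA.
  congr (_ - _); rewrite -!addrA; congr (_ + _); exact: addrC.
have MJV : (1%:M - M *m J) *m (1%:M + M *m J) = 1%:M.
  by rewrite mulmxBl mul1mx mulmxDr mulmx1 MJ2 addr0 addrK.
by rewrite -mulmxA MJV mulmx1.
Qed.

Theorem proposition4p1 (R : realType) (N k : nat) (P : R)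
    (J : 'M[R]_(2 * N)) (H : R -> 'M[R]_(2 * N))
    (X : R -> 'M[R[i]]_(2 * N)) (U : 'M[R[i]]_(2 * N, k))
    (L : {vspace 'cV[R[i]]_(2 * N)}) :
  J^T = - J -> J \in unitmx ->
  0 < P -> (forall t, H (t + P) = H t) -> (forall t, (H t)^T = H t) ->
  fundamental_solution J (fun t => cmx (H t)) X ->
  \rank U = k ->
  J_Lagrangian J L -> (forall j, col j U \in L) ->
  solves J (fun t => cmx (H t) + perturbation J U H t)
    (fun t => (1%:M + U *m U^T *m cmx J) *m X t).
Proof.
move=> JT _ _ _ HT [XH _] _ LJ UL t t0.
have [D XD JD] := XH t t0.
exists ((1%:M + U *m U^T *m cmx J) *m D); first exact: derivative_at_mulmxl.
set M := U *m U^T.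
have cJT : (cmx J)^T = - cmx J by rewrite /cmx map_trmx JT map_mxN.
have cHT : (cmx (H t))^T = cmx (H t) by rewrite /cmx map_trmx HT.
have MT : M^T = M by rewrite trmx_mul trmxK.
have MJM : M *m cmx J *m M = 0.
  have -> : M *m cmx J *m M = U *m (U^T *m cmx J *m U) *m U^T.
    by rewrite /M !mulmxA.
  by rewrite (Lagrangian_tr_mul_eq0 _ _ _ _ _ _ JT LJ UL) mulmx0 mul0mx.
rewrite /perturbation -[cmx J *m U *m _]mulmxA -/M.
(* The right side becomes (I + J M) H X, where H X is replaced by J D; both sides then expand to J D
   + J M J D. *)
rewrite [RHS]mulmxA symplectic_perturbationE // -[RHS]mulmxA -JD.
by rewrite mulmxDl mul1mx [RHS]mulmxDl mul1mx mulmxDr !mulmxA.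
Qed.
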